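(* Let $n\geq 3$, $m\geq 2$, and let $\Gamma$ be an Abelian group of order $(2m-1)n$. Suppose $\Gamma$ has a subgroup $H$ of order $n$ such that either $n$ is odd, or $n$ is even and $H$ has a subgroup isomorphic to $Z_2\oplus Z_{2s}$ for some $s\geq 2$, and suppose the quotient group $\Gamma/H$ is cyclic. Then the generalized open web $OW_{m,n}$ admits a $\Gamma$-harmonious labeling.
   Context: The generalized prism $Y_{m,n}$ is the Cartesian product $P_m\Box C_n$ (layers $C^1,\dots,C^m$ of $C_n$ with corresponding vertices of consecutive layers adjacent). The generalized closed web $CW_{m,n}$ is obtained from $Y_{m,n}$ by adding one new vertex joined to every vertex of the top cycle $C^1$. The generalized open web $OW_{m,n}$ is obtained from $CW_{m,n}$ by deleting the edges of the bottom cycle $C^m$; it has $(2m-1)n$ edges. For a graph $G=(V,E)$ with $q$ edges and a finite Abelian group $\Gamma$ of order $q$ (written additively), a $\Gamma$-harmonious labeling is an injection $f:V\to\Gamma$ such that the induced edge labeling $w(xy)=f(x)+f(y)$ is a bijection from $E$ to $\Gamma$. $Z_k$ denotes the cyclic group of order $k$. *)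

(* Defs.v *)
From mathcomp Require Import all_boot all_order all_fingroup all_algebra all_solvable.

Set Implicit Arguments.
Unset Strict Implicit.
Unset Printing Implicit Defensive.

Import GRing.Theory.

Definition path_graph (m : nat) : rel 'I_m :=
  [rel i j : 'I_m | (j == i.+1 :> nat) || (i == j.+1 :> nat)].

(* For n >= 3 this is the simple cycle C_n; for n = 1 it is a loop and for
   n = 2 a single edge. *)
Definition cycle_graph (n : nat) : rel 'I_n :=
  [rel i j : 'I_n | (j == i.+1 %% n :> nat) || (i == j.+1 %% n :> nat)].

Definition cartesian_graph (T U : finType) (e : rel T) (e' : rel U) :
    rel (T * U) :=
  [rel x y | (x.1 == y.1) && e' x.2 y.2 || (x.2 == y.2) && e x.1 y.1].

(* The pair (i, j) is the j-th vertex of the layer C^{i+1}. *)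
Definition prism (m n : nat) : rel ('I_m * 'I_n) :=
  cartesian_graph (@path_graph m) (@cycle_graph n).

Definition in_top (m n : nat) (x : 'I_m * 'I_n) : bool := x.1 == 0 :> nat.

Definition in_bottom (m n : nat) (x : 'I_m * 'I_n) : bool :=
  x.1.+1 == m :> nat.

(* The added vertex is None. *)
Definition closed_web (m n : nat) : rel (option ('I_m * 'I_n)) :=
  [rel u v | match u, v with
             | Some x, Some y => prism x y
             | Some x, None | None, Some x => in_top x
             | None, None => false
             end].

Definition bottom_cycle (m n : nat) : rel (option ('I_m * 'I_n)) :=
  [rel u v | match u, v with
             | Some x, Some y =>
                 [&& in_bottom x, in_bottom y & cycle_graph x.2 y.2]
             | _, _ => false
             end].

Definition open_web (m n : nat) : rel (option ('I_m * 'I_n)) :=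
  [rel u v | closed_web u v && ~~ bottom_cycle u v].

Definition edge_set (T : finType) (e : rel T) : {set {set T}} :=
  [set [set x; y] | x in T, y in T & e x y].

(* On an edge [set x; y] with x != y this is f x + f y. *)
Definition edge_weight (T : finType) (G : finZmodType) (f : T -> G)
    (A : {set T}) : G :=
  (\sum_(x in A) f x)%R.

(* The bijection onto G forces #|edge_set e| = #|G|. *)
Definition harmonious_labeling (T : finType) (e : rel T) (G : finZmodType)
    (f : T -> G) : Prop :=
  [/\ injective f,
      {in edge_set e &, injective (edge_weight f)}
    & edge_weight f @: edge_set e = [set: G]].

Lemma edge_weight2 (T : finType) (G : finZmodType) (f : T -> G) (x y : T) :
  x != y -> edge_weight f [set x; y] = (f x + f y)%R.
Proof.
by move=> xNy; rewrite /edge_weight big_setU1 ?big_set1 ?inE.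
Qed.

Lemma path_graph_sym (m : nat) : symmetric (@path_graph m).
Proof. by move=> i j; apply: orbC. Qed.

Lemma cycle_graph_sym (n : nat) : symmetric (@cycle_graph n).
Proof. by move=> i j; apply: orbC. Qed.

Lemma path_graph_irrefl (m : nat) : irreflexive (@path_graph m).
Proof. by move=> i; rewrite /path_graph /= orbb ltn_eqF. Qed.

Lemma cycle_graph_irrefl (n : nat) : 1 < n -> irreflexive (@cycle_graph n).
Proof.
move=> n_gt1 i; rewrite /cycle_graph /= orbb; apply/negbTE.
have := ltn_ord i; rewrite leq_eqVlt => /orP[/eqP En|lt_n].
  rewrite En modnn; apply/eqP=> i0.
  by move: n_gt1; rewrite -En i0.
by rewrite modn_small // ltn_eqF.
Qed.

Lemma open_web_sym (m n : nat) : symmetric (@open_web m n).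
Proof.
move=> u v; congr (_ && ~~ _).
  case: u v => [x|] [y|] //.
  rewrite /closed_web /prism /cartesian_graph.
  rewrite [LHS]/= [RHS]/= (eq_sym x.1) (eq_sym x.2).
  by congr (_ && _ || _ && _); [exact: cycle_graph_sym | exact: path_graph_sym].
case: u v => [x|] [y|] //.
rewrite /bottom_cycle [LHS]/= [RHS]/= andbCA.
by congr [&& _, _ & _]; exact: cycle_graph_sym.
Qed.

Lemma open_web_irrefl (m n : nat) : 1 < n -> irreflexive (@open_web m n).
Proof.
move=> n_gt1 [x|] //.
have pn := path_graph_irrefl x.1; have cn := cycle_graph_irrefl n_gt1 x.2.
by rewrite /open_web /closed_web /prism /cartesian_graph [LHS]/= pn cn !andbF.
Qed.

(* Main.v *)
Require Import Defs.
From mathcomp Require Import all_boot all_order all_fingroup all_algebra all_solvable.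
From mathcomp Require Import zify.

(* If H has a cyclic enumeration h_0, ..., h_(n-1) whose consecutive sums
   h_i + h_(i+1) again exhaust H (that is, H is harmonious), and g generates
   Gamma modulo H, then label the vertex (i, j) by i g + h_(i+j) and the added
   vertex by (2m-2) g: the cycle edges of layer i, the rungs from layer i to
   layer i+1 and the spokes fill the cosets 2i g + H, (2i+1) g + H and
   (2m-2) g + H.

   It remains to see that H is harmonious.  More generally an abelian group G
   is harmonious when it has odd order, or has at least three involutions and
   is not of exponent 2; write T for the kernel and D for the image of
   x -> x^2.  The induction on the order of G uses two extension steps:
   - from a harmonious subgroup K to an overgroup of odd index, by running
     cyclically through the cosets of K;
   - from a harmonious quotient G / V to G when V has exponent 2 and order 4
     (or order 8, if |G / V| is odd), by lifting the cycle of cosets to |V|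
     parallel strands and joining the strands by U-turns in one coset.
   A subgroup V of T of order 4 with |T| |V :&: D| >= 16 and D not contained
   in V gives a quotient satisfying the hypothesis again.  Otherwise D is odd,
   or G is Z_4 x Z_4 or Z_4 x Z_2 x Z_2, or |T| = 4 and |T :&: D| = 2, where
   the Sylow 2-subgroup is Z_2 x Z_2s with s even. *)

Section HarmoniousGroups.

Set Implicit Arguments.
Unset Strict Implicit.
Unset Printing Implicit Defensive.

Local Open Scope group_scope.

(** * Harmonious groups and subgroups of odd index *)

Lemma abelian_mulgC (gT : finGroupType) (G : {set gT}) x y :
  abelian G -> x \in G -> y \in G -> x * y = y * x.
Proof. by move=> /centsP cGG Gx; apply: cGG. Qed.

(* By counting, both enumerations of G are then bijective over one period. *)
Definition harmonious_sequence (gT : finGroupType) (G : {set gT}) (h : nat -> gT) :=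
  [/\ forall i, h (i + #|G|)%N = h i,
      {in G, forall x, exists i, x = h i}
    & {in G, forall x, exists i, x = h i * h i.+1}].

Definition harmonious (gT : finGroupType) (G : {set gT}) :=
  exists h, harmonious_sequence G h.

Lemma harmonious_modn (gT : finGroupType) (G : {set gT}) h i :
  harmonious_sequence G h -> h (i %% #|G|) = h i.
Proof.
case=> hP _ _; rewrite {2}(divn_eq i #|G|) addnC.
elim: (i %/ #|G|) => [|q IHq]; first by rewrite mul0n addn0.
by rewrite mulSnr addnA hP.
Qed.

Lemma harmonious_lt (gT : finGroupType) (G : {group gT}) h x :
  harmonious_sequence G h -> x \in G -> exists2 i, i < #|G| & x = h i.
Proof.
move=> hG; have [_ surj _] := hG => /surj[i ->].
by exists (i %% #|G|); rewrite ?ltn_mod ?cardG_gt0 ?(harmonious_modn _ hG).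
Qed.

(** One period covers G; having only [#|G|] indices, it can hit nothing else and repeat nothing. *)
Lemma harmonious_image (gT : finGroupType) (G : {group gT}) h :
  harmonious_sequence G h -> [set h i | i : 'I_#|G|] = G /\
  {in gtn #|G| &, injective h}.
Proof.
move=> hG.
have sG: G \subset [set h i | i : 'I_#|G|].
  apply/subsetP=> x /(harmonious_lt hG)[i lt_i ->].
  by apply/imsetP; exists (Ordinal lt_i).
have leG: #|[set h i | i : 'I_#|G|]| <= #|'I_#|G| |.
  by apply: leq_imset_card.
have/eqP eqG: [set h i | i : 'I_#|G|] == G.
  by rewrite eq_sym eqEcard sG /=; rewrite card_ord in leG.
split=> // i j lt_i lt_j eq_h.
have/imset_injP inj: #|[set h i | i : 'I_#|G|]| == #|'I_#|G| |.
  by rewrite eqG card_ord.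
by have [] := inj (Ordinal lt_i) (Ordinal lt_j) isT isT eq_h.
Qed.

Lemma harmonious_mem (gT : finGroupType) (G : {group gT}) h i :
  harmonious_sequence G h -> h i \in G.
Proof.
move=> hG; have [eqG _] := harmonious_image hG.
rewrite -(harmonious_modn _ hG).
have lt_i: i %% #|G| < #|G| by rewrite ltn_mod cardG_gt0.
have: h (Ordinal lt_i) \in [set h i | i : 'I_#|G|] by apply: imset_f.
by rewrite eqG.
Qed.

Lemma harmonious_shift (gT : finGroupType) (G : {group gT}) h t e :
  harmonious_sequence G h -> e <= #|G| -> exists t', h (t' + e) = h t.
Proof.
case=> hP _ _ le_e; exists (t + #|G| - e)%N.
by rewrite subnK ?hP // (leq_trans le_e) ?leq_addl.
Qed.

(* Step i of round t visits g^i h_t or g^i h_(t+1) according to the parity of i;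
   the shifts 0, 1, 0, ..., 0 close up because the index is odd. *)
Lemma harmonious_odd_index (gT : finGroupType) (G K : {group gT}) :
  abelian G -> K \subset G -> odd #|G : K| -> cyclic (G / K) ->
  harmonious K -> harmonious G.
Proof.
move=> abG sKG oddk /cyclicP[gbar defQ] [h hK].
have nKG: G \subset 'N(K) := sub_abelian_norm abG sKG.
have [hP h1 h2] := hK.
set k := #|G : K| in oddk *.
have ordg: #[gbar] = k by rewrite orderE -defQ card_quotient.
have k_gt0: 0 < k by rewrite /k indexg_gt0.
have K_gt0: 0 < #|K| by [].
have [g [Ng Gg eg]]: exists g, [/\ g \in 'N(K), g \in G & gbar = coset K g].
  have: gbar \in G / K by rewrite defQ cycle_id.
  by case/morphimP=> g Ng Gg ->; exists g.
have decomp x i : x \in G -> coset K x = gbar ^+ i ->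
    exists2 y, y \in K & x = g ^+ i * y.
  move=> Gx; rewrite eg -morphX // => eq_x.
  have [||y Ky ->] := kercoset_rcoset _ _ eq_x; rewrite ?groupX //.
    exact: subsetP Gx.
  exists y; first by [].
  by apply: (abelian_mulgC abG); [apply: (subsetP sKG) | apply: groupX].
have cosetG x : x \in G -> exists2 i, i < k & coset K x = gbar ^+ i.
  move=> Gx; have: coset K x \in <[gbar]> by rewrite -defQ mem_quotient.
  by case/cyclePmin=> i; rewrite ordg; exists i.
have hG t : h t \in G by rewrite (subsetP sKG) ?(harmonious_mem _ hK).
exists (fun j => g ^+ (j %% k) * h (j %/ k + odd (j %% k))); split.
- move=> j; rewrite -(Lagrange sKG) -/k addnC modnMDl divnMDl //.
  by rewrite -addnA addnC hP.
- move=> x Gx; have [i lt_i eq_i] := cosetG x Gx.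
  have [y Ky ->] := decomp x i Gx eq_i; have [t ->] := h1 y Ky.
  (* For odd i the visit in round t' shows h_(t'+1), so t' is t moved back by one. *)
  have [t' <-] := harmonious_shift t hK (leq_trans (leq_b1 (odd i)) K_gt0).
  exists (t' * k + i)%N.
  by rewrite modnMDl divnMDl // modn_small // divn_small // addn0.
move=> x Gx; have [j lt_j eq_j] := cosetG x Gx.
(* As k is odd, every residue j modulo k has the form 2i + 1 with i < k: one of j and j + k is
   odd. *)
have [i lt_i eq_i]: exists2 i, i < k & coset K x = gbar ^+ (i + i.+1).
  case odd_j: (odd j).
    by exists j./2; [lia | rewrite eq_j; congr (_ ^+ _); lia].
  exists (j + k)./2; first by lia.
  by rewrite eq_j -[LHS]mulg1 -(expg_order gbar) ordg -expgD; congr (_ ^+ _); lia.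
(* For i + 1 = k the neighbour opens the next round; both shifts are 0 because k - 1 is even, and
   the product is g^(k-1) h_t h_(t+1). Otherwise both neighbours lie in round t and exactly one of
   their shifts is 1. *)
case: (ltngtP i.+1 k) (lt_i) => // [lt_i1 _ | eq_ik _]; last first.
  have eq_i': coset K x = gbar ^+ i.
    by rewrite eq_i eq_ik expgD -ordg expg_order mulg1.
  have [y Ky ->] := decomp x i Gx eq_i'; have [t ->] := h2 y Ky.
  exists (t * k + i)%N.
  have ->: (t * k + i).+1 = (t.+1 * k)%N by rewrite -addnS eq_ik mulSnr.
  rewrite modnMl mulnK // modnMDl divnMDl // modn_small ?divn_small ?lt_i //.
  have ->: odd i = false by lia.
  by rewrite !addn0 mul1g mulgA.
have [y Ky ->] := decomp x _ Gx eq_i; have [t ->] := h2 y Ky.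
exists (t * k + i)%N; rewrite -addnS !modnMDl !divnMDl // !modn_small ?divn_small //;
  try lia.
rewrite /= expgD addn0 -!mulgA; congr (_ * _).
case: (odd i) => /=; rewrite ?addn0 ?addn1.
  rewrite [h t.+1 * _](abelian_mulgC abG) ?groupM ?groupX //.
  by rewrite -!mulgA; congr (_ * _); rewrite (abelian_mulgC abG).
by rewrite !mulgA; congr (_ * _); rewrite (abelian_mulgC abG) ?groupX.
Qed.

(** * Lifting from a quotient *)

Lemma nth_rot (T : Type) (x0 : T) s j i : j <= size s -> i < size s ->
  nth x0 (seq.rot j s) i = nth x0 s ((j + i) %% size s).
Proof.
move=> le_j lt_i; rewrite /rot nth_cat size_drop nth_drop; case: ltnP => lt_ij.
  by rewrite modn_small //; lia.
rewrite nth_take; last by lia.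
have ->: (j + i = (i - (size s - j)) + size s)%N by lia.
by rewrite modnDr modn_small //; lia.
Qed.

Lemma infix2_rot (T : eqType) (x0 : T) s j y z : infix [:: y; z] (seq.rot j s) ->
  exists i, y = nth x0 s (i %% size s) /\ z = nth x0 s (i.+1 %% size s).
Proof.
case/infixP=> a [b def_rot].
have [j' le_j' eq_rot]: exists2 j', j' <= size s & seq.rot j s = seq.rot j' s.
  have [le_j | lt_j] := leqP j (size s); first by exists j.
  by exists 0 => //; rewrite rot0 rot_oversize // ltnW.
have sz_s: size s = (size a + (size b).+2)%N.
  by rewrite -(size_rot j) def_rot !size_cat.
rewrite {}eq_rot in def_rot.
exists (j' + size a)%N; rewrite -addnS -!nth_rot ?def_rot //; try lia.
by rewrite !nth_cat ltnn subnn (ltnNge _.+1) leqW ?subSnn.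
Qed.

(** Cyclic neighbours are expressed as adjacent entries of some rotation, which suits lists built by
    concatenation and makes the wrap-around an ordinary case. *)
Lemma harmonious_seq (gT : finGroupType) (G : {group gT}) (s : seq gT) :
  size s = #|G| -> {subset G <= s} ->
  {in G, forall x, exists y z j, infix [:: y; z] (seq.rot j s) /\ x = y * z} ->
  harmonious G.
Proof.
move=> sz_s sGs sum_s.
exists (fun i => nth 1 s (i %% size s)); split.
- by move=> i; rewrite -sz_s modnDr.
- move=> x /sGs s_x; exists (index x s).
  by rewrite modn_small ?index_mem ?nth_index.
move=> x /sum_s[y [z [j [/(infix2_rot 1)[i [-> ->]] ->]]]].
by exists i.
Qed.

(* For v in T, the strand of v meets the i-th coset, 0 < i < k, in tau i v
   (elements of V being named by T through psi).  In the 0-th coset the end of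
   the strand of v is joined to F v and its start to g v, so that F and g are
   two-to-one.  A pair of L is a strand run forwards and the one, joined to it
   by F, that is run backwards next. *)
Lemma harmonious_strands (gT : finGroupType) (G V : {group gT}) (T : finType)
    (op : T -> T -> T) (psi : T -> gT) (tau : nat -> T -> T) (F g : T -> T)
    (L : seq (T * T)) (k := #|G / V|) :
  abelian G -> V \subset G -> harmonious (G / V) -> 1 < k ->
  {morph psi : t u / op t u >-> t * u} -> (forall t, psi t \in V) ->
  {in V, forall x, exists t, x = psi t} ->
  #|V| = (size L).*2 -> 1 < size L ->
  (forall i, 0 < i < k -> forall u, exists v, tau i v = u) ->
  (forall i, 0 < i -> i.+1 < k ->
     forall u, exists v, op (tau i v) (tau i.+1 v) = u) ->
  (forall u, exists v, op (tau k.-1 v) (F v) = u) ->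
  (forall u, exists v, op (g v) (tau 1%N v) = u) ->
  (forall u, exists v, u = F v \/ u = g v) ->
  (forall v, exists2 p, p \in L & v = p.1 \/ v = p.2) ->
  {in L, forall p, F p.1 = F p.2} ->
  path.cycle [rel p p' | g p.2 == g p'.1] L ->
  harmonious G.
Proof.
move=> abG sVG [h hQ] k_gt1 psiM psiV psi_onto cardV L_gt1 tau_onto tau_op.
move=> F_op g_op Fg_onto L_onto LF Lg.
have nVG: G \subset 'N(V) := sub_abelian_norm abG sVG.
have [hP _ h2] := hQ.
pose x i u := repr (h i) * psi u.
have hG i : repr (h i) \in G.
  have /morphimP[y Ny Gy ->] : h i \in G / V by apply: harmonious_mem hQ.
  have: repr (coset V y) \in coset V y by apply: mem_repr_coset.
  rewrite val_coset // => /rcosetP[z Vz ->].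
  by rewrite groupM // (subsetP sVG).
have xG i u : x i u \in G by rewrite groupM // (subsetP sVG).
have xM i j u v : x i u * x j v = repr (h i) * repr (h j) * psi (op u v).
  rewrite psiM /x -!mulgA; congr (_ * _); rewrite !mulgA; congr (_ * _).
  by apply: (abelian_mulgC abG) => //; apply: (subsetP sVG).
pose P v := [seq x i (tau i v) | i <- iota 1 k.-1].
(* A block runs up the strand of [p.1], turns at [F p.1 = F p.2] and runs down the strand of [p.2];
   it then leaves to the first entry of the next block, as [g p.2 = g p'.1]. *)
pose block p := x 0 (g p.1) :: P p.1 ++ x 0 (F p.1) :: rev (P p.2).
pose s := flatten [seq block p | p <- L].
have sz_P v : size (P v) = k.-1 by rewrite size_map size_iota.
have P_adj v i : 0 < i -> i.+1 < k ->
    infix [:: x i (tau i v); x i.+1 (tau i.+1 v)] (P v).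
  move=> i_gt0 lt_i; rewrite /P.
  have ->: k.-1 = (i.-1 + (2 + (k.-1 - i.+1)))%N by lia.
  rewrite iotaD map_cat /= add1n prednK //.
  exact: (infix_infix _ [:: _; _]).
have P_last v : exists a, P v = rcons a (x k.-1 (tau k.-1 v)).
  rewrite /P; have ->: k.-1 = k.-2.+1 by lia.
  by rewrite -[X in iota _ X]addn1 iotaD map_cat cats1 add1n;
    exists (map (fun i => x i (tau i v)) (iota 1 k.-2)).
have P_head v : exists a, P v = x 1%N (tau 1%N v) :: a.
  rewrite /P; have ->: k.-1 = k.-2.+1 by lia.
  by eexists.
(* Rotating [s] brings the block of p to the front; [1 < size L] ensures that another block follows
   it. *)
have s_block p : p \in L -> exists p' j b, g p.2 = g p'.1 /\
    seq.rot j s = block p ++ block p' ++ b.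
  case/rot_to=> i L' def_L.
  move: Lg; rewrite -(rot_cycle i) def_L.
  case: L' def_L => [/(congr1 size)|p' L' def_L].
    by rewrite size_rot /= => szL; rewrite szL in L_gt1.
  rewrite /= => /andP[/eqP eq_g _].
  exists p', (size (flatten [seq block q | q <- take i L])).
  exists (flatten [seq block q | q <- L']); split=> //.
  have ->: s = flatten (map block (take i L)) ++ flatten (map block (drop i L)).
    by rewrite -flatten_cat -map_cat cat_take_drop.
  rewrite rot_size_cat.
  by rewrite -flatten_cat -map_cat -/(seq.rot i L) def_L.
have s_adj p y z : p \in L -> infix [:: y; z] (block p) ->
    exists j, infix [:: y; z] (seq.rot j s).
  case/s_block=> p' [j [b [_ def_s]]] in_p.
  by exists j; rewrite def_s infix_catr.
have mem_s p y : p \in L -> y \in block p -> y \in s.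
  by move=> Lp p_y; apply/flattenP; exists (block p) => //; apply: map_f.
have cosetE y z : y \in G -> z \in G -> coset V y = coset V z ->
    exists t, y = z * psi t.
  move=> Gy Gz /kercoset_rcoset[||v Vv ->]; rewrite ?(subsetP nVG) //.
  have [t def_v] := psi_onto v Vv; exists t; rewrite def_v.
  by apply: (abelian_mulgC abG) => //; apply: (subsetP sVG).
have coset_h i : coset V (repr (h i)) = h i by apply: coset_reprK.
apply: (@harmonious_seq _ _ s).
- have ->: size s = (size L * (2 * k))%N.
    rewrite /s size_flatten /shape -map_comp.
    elim: (L) => //= p L' ->; rewrite size_cat /= size_rev !sz_P.
    by rewrite mulSn; lia.
  rewrite -(Lagrange sVG) cardV -card_quotient // -/k; lia.
- move=> y Gy.
  have [i lt_i eq_i] := harmonious_lt hQ (mem_quotient V Gy).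
  have [t ->]: exists t, y = x i t by apply: cosetE; rewrite ?coset_h.
  have [i_eq0 | i_gt0] := posnP i; last first.
    have [|v <-] := tau_onto i _ t; first by rewrite i_gt0.
    have [p Lp vp] := L_onto v; apply: (mem_s p) => //.
    have: x i (tau i v) \in P v.
      by apply: map_f; rewrite mem_iota i_gt0 add1n prednK ?(ltnW k_gt1).
    by case: vp => -> Pv; rewrite inE mem_cat inE mem_rev Pv ?orbT.
  rewrite i_eq0.
  have [v ft] := Fg_onto t; have [p Lp vp] := L_onto v.
  have [p' [j [b [eq_g def_s]]]] := s_block p Lp.
  case: ft => ->.
    have ->: F v = F p.1 by case: vp => -> //; rewrite LF.
    by apply: (mem_s p) => //; rewrite inE mem_cat inE eqxx !orbT.
  rewrite -(mem_rot j) def_s !(mem_cat, inE).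
  by case: vp => ->; rewrite ?eq_g eqxx ?orbT.
have adjP a b y : a \in G -> b \in G ->
    (exists j, infix [:: a; b] (seq.rot j s) \/ infix [:: b; a] (seq.rot j s)) ->
    y = a * b -> exists a b j, infix [:: a; b] (seq.rot j s) /\ y = a * b.
  move=> Ga Gb [j [] adj_ab ->]; first by exists a, b, j.
  by exists b, a, j; rewrite (abelian_mulgC abG Ga).
move=> y Gy; have [i lt_i eq_i]: exists2 i, i < k & coset V y = h i * h i.+1.
  have [i ->] := h2 _ (mem_quotient V Gy); exists (i %% k).
    by rewrite ltn_mod; lia.
  rewrite (harmonious_modn _ hQ); congr (_ * _).
  rewrite -[RHS](harmonious_modn _ hQ) -[LHS](harmonious_modn _ hQ).
  by rewrite -addn1 -modnDml addn1.
have [t ->]: exists t, y = repr (h i) * repr (h i.+1) * psi t.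
  apply: cosetE; rewrite ?groupM // eq_i morphM ?(subsetP nVG) //=.
  by rewrite !coset_h.
(* Three kinds of neighbours: cosets 0 and 1, joined through [g]; cosets i and i + 1 inside a
   strand; cosets k - 1 and 0, joined through [F]. Reversed strands list the pair backwards, which
   [adjP] allows. *)
have [i0 | i_gt0] := posnP i.
  have [v <-] := g_op t; rewrite i0.
  apply: (adjP (x 0 (g v)) (x 1%N (tau 1%N v))); rewrite ?xM //.
  have [p Lp vp] := L_onto v; have [p' [j [b [eq_g def_s]]]] := s_block p Lp.
  exists j; rewrite def_s; have [a def_P] := P_head v.
  case: vp def_P => -> def_P; [left | right].
    by apply: infix_catr; rewrite /block def_P; apply: (prefix_infix [:: _; _]).
  have [u ->]: exists u, block p = rcons u (x 1%N (tau 1%N p.2)).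
    exists (x 0 (g p.1) :: P p.1 ++ x 0 (F p.1) :: rev a).
    by rewrite /block def_P rev_cons -!rcons_cons -rcons_cat.
  by rewrite eq_g cat_rcons; apply: (infix_infix _ [:: _; _]).
have [lt_i1 | le_i1] := ltnP i.+1 k.
  have [v <-] := tau_op i i_gt0 lt_i1 t.
  apply: (adjP (x i (tau i v)) (x i.+1 (tau i.+1 v))); rewrite ?xM //.
  have [p Lp vp] := L_onto v; have adj_i := P_adj v i i_gt0 lt_i1.
  have [in_p | in_p]: infix [:: x i (tau i v); x i.+1 (tau i.+1 v)] (block p)
      \/ infix [:: x i.+1 (tau i.+1 v); x i (tau i v)] (block p).
  - case: vp adj_i => -> adj_i; [left | right; rewrite /block -!cat_cons].
      by apply: (@infix_catl _ _ _ [:: _]); apply: infix_catr.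
    by apply: infix_catl; apply: (@infix_catl _ _ _ [:: _]); rewrite -infix_revLR.
  - by have [j adj_j] := s_adj p _ _ Lp in_p; exists j; left.
  by have [j adj_j] := s_adj p _ _ Lp in_p; exists j; right.
have def_i: i = k.-1 by lia.
have ->: h i.+1 = h 0 by rewrite (_ : i.+1 = 0 + k)%N ?hP //; lia.
have [v <-] := F_op t; rewrite def_i.
apply: (adjP (x k.-1 (tau k.-1 v)) (x 0 (F v))); rewrite ?xM //.
have [p Lp vp] := L_onto v; have [a def_P] := P_last v.
have [in_p | in_p]: infix [:: x k.-1 (tau k.-1 v); x 0 (F v)] (block p)
    \/ infix [:: x 0 (F v); x k.-1 (tau k.-1 v)] (block p).
- case: vp def_P => -> def_P; [left | right; rewrite -LF //].
    rewrite /block def_P cat_rcons -cat_cons.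
    exact: (infix_infix _ [:: _; _]).
  rewrite /block def_P rev_rcons -cat_cons.
  exact: (infix_infix _ [:: _; _]).
- by have [j adj_j] := s_adj p _ _ Lp in_p; exists j; left.
by have [j adj_j] := s_adj p _ _ Lp in_p; exists j; right.
Qed.

(** * Three families of groups *)

(** Reduces a concrete group to evaluation on names of its elements. The default of [nth] is t
    itself, no other element of [T] being at hand; the indices are always in range. *)
Lemma harmonious_table (gT : finGroupType) (G : {group gT}) (T : eqType)
    (op : T -> T -> T) (psi : T -> gT) (dom l : seq T) :
  size l = #|G| -> {morph psi : t u / op t u >-> t * u} ->
  {in G, forall x, exists2 t, t \in dom & x = psi t} ->
  all (mem l) dom ->
  all (fun t => has (fun i => op (nth t l i) (nth t l (i.+1 %% size l)) == t)
                    (iota 0 (size l))) dom ->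
  harmonious G.
Proof.
move=> sz_l psiM psi_onto /allP dom_l /allP dom_sum.
case: l => [|t0 l0] in sz_l dom_l dom_sum *.
  by have := cardG_gt0 G; rewrite -sz_l.
set l := t0 :: l0 in sz_l dom_l dom_sum *.
exists (fun i => psi (nth t0 l (i %% size l))); split.
- by move=> i; rewrite -sz_l modnDr.
- move=> x /psi_onto[t /dom_l l_t ->]; exists (index t l).
  by rewrite modn_small ?index_mem ?nth_index.
move=> x /psi_onto[t /dom_sum/hasP[i]]; rewrite mem_iota => lt_i /eqP <- ->.
exists i; rewrite psiM (modn_small lt_i) !(set_nth_default t0 t) //.
by rewrite ltn_mod.
Qed.

Lemma harmonious_Z4xZ4 (gT : finGroupType) (G : {group gT}) x y :
  abelian G -> #|G| = 16 -> x \in G -> y \in G ->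
  {in G, forall z, exists i j, z = x ^+ i * y ^+ j} ->
  x ^+ 4 = 1 -> y ^+ 4 = 1 -> harmonious G.
Proof.
move=> abG cardG Gx Gy xy_onto x4 y4.
pose op (t u : nat * nat) := ((t.1 + u.1) %% 4, (t.2 + u.2) %% 4).
pose psi t := x ^+ t.1 * y ^+ t.2.
(* A cyclic order of the exponent pairs in which the 16 consecutive sums modulo 4 again give every
   pair; evaluation checks this. *)
pose l := [:: (0, 0); (0, 1); (0, 2); (1, 0); (0, 3); (1, 1); (1, 2); (2, 0);
  (2, 2); (1, 3); (2, 1); (2, 3); (3, 2); (3, 0); (3, 1); (3, 3)]%N.
apply: (@harmonious_table _ _ _ op psi l l) => //.
- move=> t u; rewrite /psi /op /= !expg_mod // !expgD -!mulgA.
  congr (_ * _); rewrite !mulgA; congr (_ * _).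
  by apply: (abelian_mulgC abG); apply: groupX.
move=> z /xy_onto[i [j ->]]; exists (i %% 4, j %% 4).
  have: i %% 4 < 4 by rewrite ltn_mod.
  have: j %% 4 < 4 by rewrite ltn_mod.
  by case: (i %% 4) => [|[|[|[|]]]] //; case: (j %% 4) => [|[|[|[|]]]].
by rewrite /psi !expg_mod.
Qed.

Lemma harmonious_Z4xZ2xZ2 (gT : finGroupType) (G : {group gT}) x y z :
  abelian G -> #|G| = 16 -> x \in G -> y \in G -> z \in G ->
  {in G, forall u, exists i j k, u = x ^+ i * y ^+ j * z ^+ k} ->
  x ^+ 4 = 1 -> y ^+ 2 = 1 -> z ^+ 2 = 1 -> harmonious G.
Proof.
move=> abG cardG Gx Gy Gz xyz_onto x4 y2 z2.
pose op (t u : nat * nat * nat) :=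
  ((t.1.1 + u.1.1) %% 4, (t.1.2 + u.1.2) %% 2, (t.2 + u.2) %% 2).
pose psi t := x ^+ t.1.1 * y ^+ t.1.2 * z ^+ t.2.
pose l := [:: (0, 0, 0); (0, 0, 1); (0, 1, 0); (1, 0, 0); (0, 1, 1); (2, 0, 1);
  (1, 0, 1); (2, 1, 0); (1, 1, 1); (3, 0, 1); (3, 0, 0); (3, 1, 1); (2, 1, 1);
  (3, 1, 0); (1, 1, 0); (2, 0, 0)]%N.
apply: (@harmonious_table _ _ _ op psi l l) => //.
- move=> t u; rewrite /psi /op /= !expg_mod // !expgD.
  rewrite -!mulgA; congr (_ * _).
  rewrite !mulgA -(abelian_mulgC abG (groupX u.1.1 Gx)) ?groupM ?groupX //.
  rewrite -!mulgA; congr (_ * _); congr (_ * _); rewrite !mulgA; congr (_ * _).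
  by apply: (abelian_mulgC abG); apply: groupX.
move=> u /xyz_onto[i [j [k ->]]]; exists (i %% 4, j %% 2, k %% 2).
  have: i %% 4 < 4 by rewrite ltn_mod.
  have: j %% 2 < 2 by rewrite ltn_mod.
  have: k %% 2 < 2 by rewrite ltn_mod.
  case: (i %% 4) => [|[|[|[|]]]] //; case: (j %% 2) => [|[|]] //;
    by case: (k %% 2) => [|[|]].
by rewrite /psi !expg_mod.
Qed.

(* The enumeration is 1, x, ..., x^(s-1) followed by the triples x^(s+i), w x^i,
   w x^(s+i) for i < s. *)
Lemma harmonious_Z2xcyclic (gT : finGroupType) (G : {group gT}) w x s :
  abelian G -> ~~ odd s -> #|G| = (4 * s)%N -> w \in G -> x \in G ->
  {in G, forall y, exists i j, y = w ^+ i * x ^+ j} ->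
  w ^+ 2 = 1 -> x ^+ (2 * s) = 1 -> harmonious G.
Proof.
move=> abG even_s cardG Gw Gx wx_onto w2 x2s.
have s_gt0: 0 < s by have := cardG_gt0 G; rewrite cardG; lia.
pose h0 r := if r < s then x ^+ r else
  let i := (r - s) %/ 3 in
  match (r - s) %% 3 with
  | 0 => x ^+ (s + i) | 1 => w * x ^+ i | _ => w * x ^+ (s + i) end.
have h0a r : r < s -> h0 r = x ^+ r by rewrite /h0 => ->.
have h0b i : h0 (s + 3 * i)%N = x ^+ (s + i).
  rewrite /h0 ltnNge leq_addr addKn mulnC modnMl mulnK //.
have h0c i : h0 (s + 3 * i).+1 = w * x ^+ i.
  by rewrite -addn1 /h0 -addnA ltnNge leq_addr addKn mulnC modnMDl divnMDl // addn0.
have h0d i : h0 (s + 3 * i).+2 = w * x ^+ (s + i).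
  by rewrite -addn2 /h0 -addnA ltnNge leq_addr addKn mulnC modnMDl divnMDl // addn0.
have onto y : y \in G -> exists (b : bool) j, j < 2 * s /\ y = w ^+ b * x ^+ j.
  case/wx_onto=> i [j ->]; exists (odd i), (j %% (2 * s)).
  rewrite ltn_mod -modn2 !expg_mod //; split=> //; lia.
have ltE r : r < 4 * s -> h0 (r %% (4 * s)) = h0 r by move=> ?; rewrite modn_small.
have Cw i : w * x ^+ i = x ^+ i * w by apply: (abelian_mulgC abG) => //; apply: groupX.
have x2s' i : x ^+ (2 * s + i) = x ^+ i by rewrite expgD x2s mul1g.
exists (fun i => h0 (i %% (4 * s))); split.
- by move=> i; rewrite cardG modnDr.
- move=> y /onto[b [j [lt_j ->]]]; have [lt_js | le_sj] := ltnP j s; case: b => /=.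
  + by exists (s + 3 * j).+1; rewrite ltE ?h0c ?expg1 //; lia.
  + by exists j; rewrite ltE ?h0a ?mul1g //; lia.
  + exists (s + 3 * (j - s)).+2; rewrite ltE ?h0d ?subnKC ?expg1 //; lia.
  + exists (s + 3 * (j - s))%N; rewrite ltE ?h0b ?subnKC ?mul1g //; lia.
move=> y /onto[b [j [lt_j ->]]].
have [j_odd | j_even] := boolP (odd j); last first.
  (* Since s is even, s + 2i with i < s runs through the even residues modulo 2s; these products
     come from the two steps inside a triple. *)
  have [i lt_i ej]: exists2 i, i < s & x ^+ j = x ^+ (s + i + i).
    have [lt_js | le_sj] := ltnP j s.
      by exists (j + s)./2; [lia | rewrite -[LHS]x2s'; congr (_ ^+ _); lia].
    by exists (j - s)./2; [lia | congr (_ ^+ _); lia].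
  rewrite ej; case: b => /=.
    exists (s + 3 * i)%N; rewrite !ltE ?h0b ?h0c ?expg1; try lia.
    by rewrite mulgA -Cw -mulgA -expgD.
  exists (s + 3 * i).+1; rewrite !ltE ?h0c ?h0d ?expg1; try lia.
  rewrite mul1g {1}Cw !mulgA -(mulgA _ w w) -[w * w]/(w ^+ 2) w2 mulg1 -expgD.
  by congr (_ ^+ _); lia.
(* Odd exponents: x^i x^(i+1) along the initial run gives those without w, the step from one triple
   to the next (or from the last one back to 1) those with w. *)
have [i lt_i ->]: exists2 i, i < s & j = (i + i.+1)%N.
  by exists j./2; lia.
case: b => /=; last first.
  exists i; rewrite mul1g (ltE i) ?(h0a i) //; last by lia.
  have [lt_i1 | le_i1] := ltnP i.+1 s; first by rewrite ltE ?h0a ?expgD //; lia.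
  have ->: i.+1 = (s + 3 * 0)%N by lia.
  by rewrite ltE ?h0b ?addn0 ?expgD //; lia.
exists (s + 3 * i).+2; rewrite (ltE _.+2) ?h0d; last by lia.
have [lt_i1 | le_i1] := ltnP i.+1 s.
  have ->: (s + 3 * i).+3 = (s + 3 * i.+1)%N by lia.
  rewrite ltE ?h0b -?mulgA -?expgD ?expg1; last by lia.
  by congr (_ * _); rewrite -[LHS]x2s'; congr (_ ^+ _); lia.
have ->: (s + 3 * i).+3 = (4 * s)%N by lia.
rewrite modnn h0a // mulg1 expg1; congr (_ * x ^+ _); lia.
Qed.

(** * Quotients by elementary abelian groups of order 4 and 8 *)

(** Splits one basis vector off V; repeated use gives bit coordinates on groups of order 4 and 8. *)
Lemma abelem2_split (gT : finGroupType) (V : {group gT}) x :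
  2.-abelem V -> x \in V -> x != 1 ->
  exists U : {group gT}, [/\ 2.-abelem U, U \subset V, #|V| = (2 * #|U|)%N,
    x \notin U & {in V, forall v, exists b : bool, exists2 u, u \in U & v = x ^+ b * u}].
Proof.
move=> abV Vx ntx; have [U [sUV cardU defV]] := p_abelem_split1 abV Vx.
have ox: #[x] = 2.
  by case/(abelemP (isT : prime 2)): abV => _ x2; apply: nt_prime_order; rewrite ?x2.
have [_ mulV _ tiU] := dprodP defV.
have x_id: x \in <[x]> by apply: cycle_id.
exists U; split=> //; first exact: abelemS abV.
- by rewrite cardU ox mulnC divnK // -ox order_dvdG.
- apply: contra ntx => Ux.
  have: x \in <[x]> :&: U by rewrite inE x_id.
  by rewrite tiU => /set1P->.
rewrite -mulV => _ /mulsgP[y u /cyclePmin[i]] + -> Uu ->.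
rewrite ox => lt_i; exists (i == 1%N); exists u => //.
by case: i lt_i => [|[|]].
Qed.

Ltac find_bits := first
  [ by exists (false, false) | by exists (true, false)
  | by exists (false, true) | by exists (true, true)
  | by exists (false, false, false) | by exists (true, false, false)
  | by exists (false, true, false) | by exists (true, true, false)
  | by exists (false, false, true) | by exists (true, false, true)
  | by exists (false, true, true) | by exists (true, true, true)].

(* A and B are the multiplications by the two primitive elements of F_4; the
   maps v -> v + A v, v -> v + B v and v -> A v + B v are bijective.  The
   U-turns close all four strands into a single cycle because the monodromy A
   (k odd) or B (k even) is not the identity. *)
Lemma harmonious_quotient4 (gT : finGroupType) (G V : {group gT}) :
  abelian G -> V \subset G -> 2.-abelem V -> #|V| = 4 ->
  2 < #|G / V| -> harmonious (G / V) -> harmonious G.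
Proof.
move=> abG sVG abV cardV k_gt2 hQ.
have V2 v : v \in V -> v ^+ 2 = 1.
  by case/(abelemP (isT : prime 2)): abV => _; apply.
have [|a Va nta] := trivgPn V _; first by rewrite -cardG_gt1 cardV.
have [U [abU sUV cardU _ defV]] := abelem2_split abV Va nta.
have oU: #|U| = 2 by move: cardU; rewrite cardV; clear; lia.
have [|b Ub ntb] := trivgPn U _; first by rewrite -cardG_gt1 oU.
have [U1 [_ _ cardU1 _ defU]] := abelem2_split abU Ub ntb.
have Vb := subsetP sUV b Ub.
have U1_1: U1 :=: 1 by apply: card1_trivg; move: cardU1; rewrite oU; clear; lia.
pose op (u v : bool * bool) := (u.1 (+) v.1, u.2 (+) v.2).
pose psi (u : bool * bool) := a ^+ u.1 * b ^+ u.2.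
pose A (u : bool * bool) := (u.2, u.1 (+) u.2).
pose B (u : bool * bool) := (u.1 (+) u.2, u.1).
(* [f] and [g] depend on the second bit only, hence are two-to-one; their values have second bit 0
   and 1 respectively, and u + f u and u + g u are bijective. *)
pose f (u : bool * bool) := (u.2, false).
pose g (u : bool * bool) := (u.2, true).
pose tau i := if i == 1%N then id else if odd i then B else A.
have abel_ab i j : b ^+ i * a ^+ j = a ^+ j * b ^+ i.
  by apply: (abelian_mulgC abG); rewrite groupX // (subsetP sVG).
have expb (c : gT) (i j : bool) : c ^+ 2 = 1 -> c ^+ (i (+) j) = c ^+ i * c ^+ j.
  by move=> c2; case: i; case: j; rewrite ?mulg1 ?mul1g //= -c2.
have psiM: {morph psi : t u / op t u >-> t * u}.
  move=> t u; rewrite /psi !expb ?V2 // -!mulgA; congr (_ * _).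
  by rewrite !mulgA abel_ab.
have psiV t : psi t \in V by rewrite groupM // groupX.
have psi_onto: {in V, forall x, exists t, x = psi t}.
  move=> x /defV[i [u Uu ->]]; have [j [v]] := defU u Uu.
  by rewrite U1_1 => /set1P-> ->; exists (i, j); rewrite mulg1.
set k := #|G / V| in k_gt2.
have tau_k: tau k.-1 = if odd k then A else B.
  rewrite /tau; case: eqP => [|_]; first by clear -k_gt2; lia.
  by have ->: odd k.-1 = ~~ odd k; [clear -k_gt2; lia | case: (odd k)].
(* [F] pairs the strands with equal second bit of A v (k odd) or B v (k even), and [g] those with
   equal second bit of v; using the two pairings alternately visits all four strands. *)
pose L := if odd k
  then [:: ((false, false), (true, true)); ((false, true), (true, false))]
  else [:: ((false, false), (false, true)); ((true, true), (true, false))].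
apply: (@harmonious_strands _ G V _ op psi tau (f \o tau k.-1) g L) => //.
- exact: ltnW.
- by rewrite cardV /L; case: ifP.
- by rewrite /L; case: ifP.
- by move=> i _ u; rewrite /tau; do 2?case: ifP => _; case: u => [[] []]; find_bits.
- move=> i i_gt0 _ u; rewrite /tau /=; case: i i_gt0 => [//|[|i]] _ /=.
    by case: u => [[] []]; find_bits.
  by case: (odd i); case: u => [[] []]; find_bits.
- by rewrite /= tau_k; case: ifP => _ [[] []]; find_bits.
- by move=> [[] []]; find_bits.
- rewrite /= tau_k; case: ifP => _ [[] []];
  by first [exists (false, false); by [left | right]
    | exists (true, false); by [left | right]
    | exists (false, true); by [left | right]
    | exists (true, true); by [left | right]].
- by move=> v; rewrite /L; case: ifP => _; case: v => [[] []];
    first [by eexists; [apply: mem_head | left]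
          | by eexists; [apply: mem_head | right]
          | by eexists; [apply: mem_last | left]
          | by eexists; [apply: mem_last | right]].
- rewrite /= tau_k /L; case: ifP => _ p; rewrite !inE => /orP[] /eqP-> //.
- by rewrite /L; case: ifP.
Qed.

(* Here A is the multiplication by a primitive element of F_8 and B is its square;
   the tables of F and g were found by computer search. *)
Lemma harmonious_quotient8 (gT : finGroupType) (G V : {group gT}) :
  abelian G -> V \subset G -> 2.-abelem V -> #|V| = 8 ->
  2 < #|G / V| -> odd #|G / V| -> harmonious (G / V) -> harmonious G.
Proof.
move=> abG sVG abV cardV k_gt2 odd_k hQ.
have V2 v : v \in V -> v ^+ 2 = 1.
  by case/(abelemP (isT : prime 2)): abV => _; apply.
have [|a Va nta] := trivgPn V _; first by rewrite -cardG_gt1 cardV.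
have [U [abU sUV cardU _ defV]] := abelem2_split abV Va nta.
have oU: #|U| = 4 by move: cardU; rewrite cardV; clear; lia.
have [|b Ub ntb] := trivgPn U _; first by rewrite -cardG_gt1 oU.
have [U1 [abU1 sU1 cardU1 _ defU]] := abelem2_split abU Ub ntb.
have oU1: #|U1| = 2 by move: cardU1; rewrite oU; clear; lia.
have [|c U1c ntc] := trivgPn U1 _; first by rewrite -cardG_gt1 oU1.
have [U2 [_ _ cardU2 _ defU1]] := abelem2_split abU1 U1c ntc.
have Vb := subsetP sUV b Ub.
have Vc := subsetP sUV c (subsetP sU1 c U1c).
have U2_1: U2 :=: 1 by apply: card1_trivg; move: cardU2; rewrite oU1; clear; lia.
pose bits : Type := (bool * bool * bool)%type.
pose op (u v : bits) := (u.1.1 (+) v.1.1, u.1.2 (+) v.1.2, u.2 (+) v.2).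
pose psi (u : bits) := a ^+ u.1.1 * b ^+ u.1.2 * c ^+ u.2.
pose A (u : bits) := (u.2, u.1.1 (+) u.2, u.1.2).
pose B (u : bits) := (u.1.2, u.1.2 (+) u.2, u.1.1 (+) u.2).
(* Bit triples are numbered in binary to tabulate [F], [g] and [L]. As k is odd, the last strand map
   is always [A], so one table suffices. *)
pose code (u : bits) := (u.1.1 + 2 * u.1.2 + 4 * u.2)%N.
pose dec n : bits := (odd n, odd n./2, odd n./2./2).
pose F (u : bits) := dec (nth 0 [:: 1; 7; 3; 2; 1; 2; 7; 3]%N (code u)).
pose g (u : bits) := dec (nth 0 [:: 5; 5; 0; 4; 4; 6; 0; 6]%N (code u)).
pose tau i := if i == 1%N then id else if odd i then B else A.
pose L := [seq (dec p.1, dec p.2) | p <- [:: (0, 4); (3, 5); (7, 2); (6, 1)]%N].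
have abel_V x y i j : x \in V -> y \in V -> x ^+ i * y ^+ j = y ^+ j * x ^+ i.
  by move=> Vx Vy; apply: (abelian_mulgC abG); rewrite groupX // (subsetP sVG).
have expb (x : gT) (i j : bool) : x ^+ 2 = 1 -> x ^+ (i (+) j) = x ^+ i * x ^+ j.
  by move=> x2; case: i; case: j; rewrite ?mulg1 ?mul1g //= -x2.
have psiM: {morph psi : t u / op t u >-> t * u}.
  move=> t u; rewrite /psi !expb ?V2 // -!mulgA; congr (_ * _).
  rewrite (mulgA (c ^+ _)) (abel_V c a) // -!mulgA !(mulgA _ (a ^+ _)) (abel_V b a) //.
  rewrite -!mulgA; congr (_ * _).
  by rewrite !mulgA; congr (_ * _); rewrite -!mulgA (abel_V c b).
have psiV t : psi t \in V by rewrite !groupM // groupX.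
have psi_onto: {in V, forall x, exists t, x = psi t}.
  move=> x /defV[i [u /defU[j [v]]]] /defU1[l [w]].
  by rewrite U2_1 => /set1P-> -> -> ->; exists (i, j, l); rewrite mulg1 mulgA.
set k := #|G / V| in k_gt2 odd_k.
have tau_k: tau k.-1 = A.
  rewrite /tau; case: eqP => [|_]; first by clear -k_gt2; lia.
  by have ->: odd k.-1 = ~~ odd k; [clear -k_gt2; lia | rewrite odd_k].
apply: (@harmonious_strands _ G V _ op psi tau F g L) => //.
- exact: ltnW.
- by move=> i _ u; rewrite /tau; do 2?case: ifP => _; case: u => [[[] []] []]; find_bits.
- move=> i i_gt0 _ u; rewrite /tau /=; case: i i_gt0 => [//|[|i]] _ /=.
    by case: u => [[[] []] []]; find_bits.
  by case: (odd i); case: u => [[[] []] []]; find_bits.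
- by rewrite /= tau_k => -[[[] []] []]; find_bits.
- by move=> [[[] []] []]; find_bits.
- move=> u; have: u \in [seq F p.1 | p <- L] ++ [seq g p.1 | p <- L].
    by case: u => [[[] []] []].
  by rewrite mem_cat => /orP[] /mapP[p _ ->]; exists p.1; [left | right].
- move=> v; have: v \in map fst L ++ map snd L by case: v => [[[] []] []].
  by rewrite mem_cat => /orP[] /mapP[p Lp ->]; exists p => //; [left | right].
- by move=> p; rewrite !inE => /or4P[] /eqP->.
Qed.

(** * Abelian groups *)

Definition square_torsion (gT : finGroupType) (G : {set gT}) : {set gT} :=
  [set x in G | x ^+ 2 == 1].

Definition squares (gT : finGroupType) (G : {set gT}) : {set gT} :=
  [set x ^+ 2 | x in G].

Lemma abelian_squaring (gT : finGroupType) (G : {group gT}) : abelian G ->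
  exists f : {morphism G >-> gT},
    [/\ {in G, forall x, f x = x ^+ 2}, 'ker f = square_torsion G :> {set gT}
      & f @* G = squares G :> {set gT}].
Proof.
move=> abG.
have fM: {in G &, {morph (fun x => x ^+ 2) : x y / x * y}}.
  by move=> x y Gx Gy; apply: expgMn; apply: abelian_mulgC abG _ _.
exists (Morphism fM); split=> //.
- by apply/setP=> x; rewrite !inE; case: (x \in G).
- by rewrite morphimEdom.
Qed.

Lemma abelian_squaring_groups (gT : finGroupType) (G : {group gT}) : abelian G ->
  exists T D : {group gT}, [/\ T = square_torsion G :> {set gT},
    D = squares G :> {set gT}, T \subset G, D \subset G & #|G| = (#|T| * #|D|)%N].
Proof.
move=> abG; have [f [fE kerf imf]] := abelian_squaring abG.
exists ('ker f)%G, (f @* G)%G; split=> //.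
- by rewrite /= kerf; apply/subsetP=> x; rewrite inE => /andP[].
- by rewrite /= imf; apply/subsetP=> _ /imsetP[x Gx ->]; apply: groupX.
by rewrite /= card_morphim setIid Lagrange ?subsetIl.
Qed.

Lemma square_torsion_abelem (gT : finGroupType) (G T : {group gT}) :
  abelian G -> T = square_torsion G :> {set gT} -> 2.-abelem T.
Proof.
move=> abG defT; apply/(abelemP (isT : prime 2)); split.
  by apply: abelianS abG; rewrite defT; apply/subsetP=> x; rewrite inE => /andP[].
by move=> x; rewrite defT inE => /andP[_ /eqP].
Qed.

(** By Cauchy, a [D] of even order contains an involution, and every involution of G lies in [T]. *)
Lemma odd_squares (gT : finGroupType) (G T D : {group gT}) :
  T = square_torsion G :> {set gT} -> D \subset G -> T :&: D = 1 -> odd #|D|.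
Proof.
move=> defT sDG tiTD; apply: contraT => even_D.
have [x Dx ox] : {x | x \in D & #[x] = 2} by apply: Cauchy; rewrite ?dvdn2.
have: x \in T :&: D.
  by rewrite inE Dx defT inE (subsetP sDG) //= -ox expg_order eqxx.
by rewrite tiTD => /set1P x1; rewrite x1 order1 in ox.
Qed.

(** The preimage W of [V :&: D] under squaring has order |T| |V :&: D| >= 16 and contains V, and the
    elements of W / V square to 1. A square outside V remains a nontrivial square in G / V. *)
Lemma quotient_square_torsion (gT : finGroupType) (G T D V : {group gT}) :
  abelian G -> T = square_torsion G :> {set gT} -> D = squares G :> {set gT} ->
  V \subset T -> #|V| = 4 -> 16 <= #|T| * #|V :&: D| -> ~~ (D \subset V) ->
  4 <= #|square_torsion (G / V)| /\ squares (G / V) != 1.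
Proof.
move=> abG defT defD sVT cardV le16 nDV.
have [f [fE kerf imf]] := abelian_squaring abG.
have sVG: V \subset G.
  by apply: subset_trans sVT _; rewrite defT; apply/subsetP=> x; rewrite inE => /andP[].
have nVG: G \subset 'N(V) := sub_abelian_norm abG sVG.
split; last first.
  have [d Dd nVd] := subsetPn nDV.
  move: Dd; rewrite defD => /imsetP[x Gx def_d].
  apply: contraNneq nVd => sq1; rewrite def_d.
  apply: coset_idr; first by rewrite (subsetP nVG) ?groupX.
  apply/set1P; rewrite -set1gE -sq1; apply/imsetP.
  exists (coset V x); first exact: mem_quotient.
  by rewrite morphX // (subsetP nVG).
pose W := (f @*^-1 (V :&: D))%G.
have cardW: #|W| = (#|T| * #|V :&: D|)%N.
  by rewrite card_morphpre ?kerf -?defT //= imf -defD subsetIr.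
have sWG: W \subset G by apply: subsetIl.
have sVW: V \subset W.
  apply/subsetP=> v Vv; have := subsetP sVT v Vv; rewrite defT inE => /andP[Gv /eqP v2].
  by rewrite !inE Gv fE // v2 !group1.
apply: leq_trans (_ : #|W / V| <= _).
  rewrite card_quotient ?(subset_trans sWG) // -divgS // cardV cardW.
  by rewrite leq_divRL.
apply: subset_leq_card; apply/subsetP=> _ /morphimP[x Nx Wx ->].
move: Wx; rewrite !inE => /andP[Gx]; rewrite fE // => /andP[Vx2 _].
by rewrite mem_quotient // -morphX //= coset_id.
Qed.

(** Adjoining one element of G at a time makes each quotient cyclic, and every partial index divides
    the odd index of K. *)
Lemma harmonious_odd_overgroup (gT : finGroupType) (G K : {group gT}) :
  abelian G -> K \subset G -> odd #|G : K| -> harmonious K -> harmonious G.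
Proof.
move=> abG; have [n] := ubnP #|G : K|; elim: n K => // n IHn K le_n sKG oddGK hK.
have [sGK | /subsetPn[x Gx nKx]] := boolP (G \subset K).
  by have -> : G = K by apply/val_inj/eqP; rewrite /= eqEsubset sGK.
pose M := (K <*> <[x]>)%G.
have sKM: K \subset M := joing_subl _ _.
have sMG: M \subset G by rewrite join_subG sKG cycle_subG.
have Mx: x \in M by rewrite (subsetP (joing_subr _ _)) ?cycle_id.
have indexM: (#|G : M| * #|M : K|)%N = #|G : K| by rewrite Lagrange_index.
have gt1: 1 < #|M : K|.
  rewrite indexg_gt1; apply: contra nKx => sMK.
  exact: (subsetP sMK).
move: oddGK; rewrite -indexM oddM => /andP[oddGM oddMK].
have nKx': x \in 'N(K) by rewrite (subsetP (sub_abelian_norm abG sKG)).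
apply: (IHn M) => //.
  by rewrite -ltnS; apply: leq_trans le_n; rewrite ltnS -indexM ltn_Pmulr ?indexg_gt0.
apply: (harmonious_odd_index (abelianS sMG abG) sKM) => //.
by rewrite quotientYidl ?cycle_subG // quotient_cycle // cycle_cyclic.
Qed.

Lemma harmonious_odd (gT : finGroupType) (G : {group gT}) :
  abelian G -> odd #|G| -> harmonious G.
Proof.
move=> abG oddG; apply: (@harmonious_odd_overgroup _ G 1%G) => //.
- exact: sub1G.
- by rewrite indexg1.
by exists (fun=> 1); split=> // x /set1P->; exists 0; rewrite ?mulg1.
Qed.

Lemma eq_squares (gT : finGroupType) (G T : {group gT}) x y :
  abelian G -> T = square_torsion G :> {set gT} -> x \in G -> y \in G ->
  x ^+ 2 = y ^+ 2 -> exists2 t, t \in T & x = y * t.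
Proof.
move=> abG defT Gx Gy eq_xy; exists (y^-1 * x); last by rewrite mulKVg.
rewrite defT inE groupM ?groupV //= expgMn; last first.
  by apply: (abelian_mulgC abG); rewrite ?groupV.
by rewrite expgVn eq_xy mulVg.
Qed.

(** This is Z_4 x Z_4. Square roots x, y of a basis of [T] generate G: each z has the same square as
    some x^i y^j, and the two differ by an element of [T], which x^2 and y^2 generate. *)
Lemma harmonious_squares_torsion4 (gT : finGroupType) (G T : {group gT}) :
  abelian G -> T = square_torsion G :> {set gT} -> T = squares G :> {set gT} ->
  #|T| = 4 -> #|G| = 16 -> harmonious G.
Proof.
move=> abG defT defD cardT cardG.
have abT := square_torsion_abelem abG defT.
have [|a Ta nta] := trivgPn T _; first by rewrite -cardG_gt1 cardT.
have [U [abU sUT cardU _ defTU]] := abelem2_split abT Ta nta.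
have oU: #|U| = 2 by move: cardU; rewrite cardT; clear; lia.
have [|b Ub ntb] := trivgPn U _; first by rewrite -cardG_gt1 oU.
have [U1 [_ _ cardU1 _ defU]] := abelem2_split abU Ub ntb.
have U1_1: U1 :=: 1 by apply: card1_trivg; move: cardU1; rewrite oU; clear; lia.
have onto t : t \in T -> exists i j, t = a ^+ i * b ^+ j.
  case/defTU=> i [u Uu ->]; have [j [v]] := defU u Uu.
  by rewrite U1_1 => /set1P-> ->; exists i, j; rewrite mulg1.
have T2 t : t \in T -> t ^+ 2 = 1.
  by case/(abelemP (isT : prime 2)): abT => _; apply.
have Tb := subsetP sUT b Ub.
have := Ta; rewrite defD => /imsetP[x Gx def_a].
have := Tb; rewrite defD => /imsetP[y Gy def_b].
have Cxy i j : x ^+ i * y ^+ j = y ^+ j * x ^+ i.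
  by apply: (abelian_mulgC abG); apply: groupX.
apply: (@harmonious_Z4xZ4 _ G x y) => //; last 2 first.
- by rewrite (expgM x 2 2) -def_a T2.
- by rewrite (expgM y 2 2) -def_b T2.
move=> z Gz; have: z ^+ 2 \in T by rewrite defD; apply: imset_f.
case/onto=> i [j def_z2].
have [||t Tt ->] := @eq_squares _ G T z (x ^+ i * y ^+ j) abG defT Gz.
- by rewrite groupM ?groupX.
- rewrite def_z2 def_a def_b [RHS]expgMn; last exact: Cxy.
  by rewrite -!expgM mulnC (mulnC 2).
have [i' [j' ->]] := onto t Tt.
exists (i + 2 * i')%N, (j + 2 * j')%N.
rewrite def_a def_b -!expgM (expgD x i) (expgD y j) -!mulgA; congr (_ * _).
by rewrite !mulgA -Cxy.
Qed.

(** This is Z_4 x Z_2 x Z_2, with w = x^2 the only nontrivial square and w, a, b a basis of [T]. *)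
Lemma harmonious_squares2 (gT : finGroupType) (G T D : {group gT}) w :
  abelian G -> T = square_torsion G :> {set gT} -> D = squares G :> {set gT} ->
  #|T| = 8 -> #|D| = 2 -> #|G| = 16 -> w \in T -> w \in D -> w != 1 -> harmonious G.
Proof.
move=> abG defT defD cardT cardD cardG Tw Dw ntw.
have abT := square_torsion_abelem abG defT.
have sTG: T \subset G by rewrite defT; apply/subsetP=> x; rewrite inE => /andP[].
have [U [abU sUT cardU _ defTU]] := abelem2_split abT Tw ntw.
have oU: #|U| = 4 by move: cardU; rewrite cardT; clear; lia.
have [|a Ua nta] := trivgPn U _; first by rewrite -cardG_gt1 oU.
have [U1 [abU1 sU1 cardU1 _ defU]] := abelem2_split abU Ua nta.
have oU1: #|U1| = 2 by move: cardU1; rewrite oU; clear; lia.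
have [|b U1b ntb] := trivgPn U1 _; first by rewrite -cardG_gt1 oU1.
have [U2 [_ _ cardU2 _ defU1]] := abelem2_split abU1 U1b ntb.
have U2_1: U2 :=: 1 by apply: card1_trivg; move: cardU2; rewrite oU1; clear; lia.
have T2 t : t \in T -> t ^+ 2 = 1.
  by case/(abelemP (isT : prime 2)): abT => _; apply.
have Ta := subsetP sUT a Ua.
have Tb := subsetP sUT b (subsetP sU1 b U1b).
have := Dw; rewrite defD => /imsetP[x Gx def_w].
have defDw: D = [set 1; w] :> {set gT}.
  apply/esym/eqP; rewrite eqEcard cards2 eq_sym ntw cardD andbT.
  by apply/subsetP=> y /set2P[] ->.
apply: (@harmonious_Z4xZ2xZ2 _ G x a b);
  rewrite ?T2 ?(subsetP sTG a Ta) ?(subsetP sTG b Tb) //; last first.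
  by rewrite (expgM x 2 2) -def_w T2.
move=> z Gz; have [i [t Tt ->]]: exists i, exists2 t, t \in T & z = x ^+ i * t.
  have: z ^+ 2 \in D by rewrite defD; apply: imset_f.
  rewrite defDw => /set2P[z2 | z2].
    by exists 0, z; rewrite ?mul1g // defT inE Gz z2 eqxx.
  by exists 1%N; apply: (eq_squares abG defT) => //; rewrite z2 def_w.
have [i' [u /defU[j [v /defU1[k [s]]]]]] := defTU t Tt.
rewrite U2_1 => /set1P-> -> -> ->; exists (i + 2 * i')%N, j, k.
by rewrite def_w -expgM (expgD x i) mulg1 !mulgA.
Qed.

(** [T :&: D] is the 2-torsion of [D], so the 2-group [D] is cyclic, generated by some y = x^2. With
    w in [T] outside [D], the elements w and x generate G. *)
Lemma harmonious_torsion_meet2 (gT : finGroupType) (G T D : {group gT}) :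
  abelian G -> T = square_torsion G :> {set gT} -> D = squares G :> {set gT} ->
  #|T| = 4 -> #|T :&: D| = 2 -> #|G| = (4 * #|D|)%N -> 2.-group G -> harmonious G.
Proof.
move=> abG defT defD cardT cardTD cardG pG.
have abT := square_torsion_abelem abG defT.
have sTG: T \subset G by rewrite defT; apply/subsetP=> x; rewrite inE => /andP[].
have sDG: D \subset G by rewrite defD; apply/subsetP=> _ /imsetP[x Gx ->]; apply: groupX.
have abD := abelianS sDG abG; have pD := pgroupS sDG pG.
have /cyclicP[y defDy]: cyclic D.
  have abO := Ohm1_abelem pD abD.
  rewrite abelian_rank1_cyclic // -rank_Ohm1 (rank_abelem abO).
  apply: leq_trans (_ : logn 2 #|T :&: D| <= 1); last by rewrite cardTD.
  apply: dvdn_leq_log; rewrite ?cardG_gt0 //; apply: cardSg.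
  rewrite subsetI Ohm_sub andbT defT; apply/subsetP=> x Ox.
  have Dx := subsetP (Ohm_sub 1 D) x Ox.
  rewrite inE (subsetP sDG x Dx) /=.
  by case/(abelemP (isT : prime 2)): abO => _ /(_ x Ox) ->.
have [|s TDs nts] := trivgPn (T :&: D)%G _; first by rewrite -cardG_gt1 cardTD.
have [Ts Ds] := setIP TDs.
have [U [abU sUT cardU nUs defTU]] := abelem2_split abT Ts nts.
have oU: #|U| = 2 by move: cardU; rewrite cardT; clear; lia.
have [|w Uw ntw] := trivgPn U _; first by rewrite -cardG_gt1 oU.
have defU: U = [set 1; w] :> {set gT}.
  apply/esym/eqP; rewrite eqEcard cards2 eq_sym ntw oU andbT.
  by apply/subsetP=> u /set2P[] ->.
have Tw := subsetP sUT w Uw.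
have T2 t : t \in T -> t ^+ 2 = 1.
  by case/(abelemP (isT : prime 2)): abT => _; apply.
have Dy: y \in D by rewrite defDy cycle_id.
have := Dy; rewrite defD => /imsetP[x Gx def_y].
have even_D: ~~ odd #|D|.
  by rewrite -dvdn2 -cardTD cardSg ?subsetIr.
apply: (@harmonious_Z2xcyclic _ G w x #|D|);
  rewrite ?T2 ?(subsetP sTG w Tw) //; last first.
  by rewrite expgM -def_y -(expg_cardG Dy).
move=> z Gz; have: z ^+ 2 \in D by rewrite defD; apply: imset_f.
rewrite defDy => /cycleP[i z2].
have [||t Tt ->] := @eq_squares _ G T z (x ^+ i) abG defT Gz.
- exact: groupX.
- by rewrite z2 def_y -!expgM mulnC.
have [b [u]] := defTU t Tt; rewrite defU => u_w ->.
have [j ->]: exists j, u = w ^+ j.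
  by case/set2P: u_w => ->; [exists 0 | exists 1%N].
(* The involution s of [D] is an even power of x and is absorbed into the exponent of x. *)
move: Ds; rewrite defDy => /cycleP[l ->].
exists j, (i + 2 * (l * b))%N.
rewrite def_y -!expgM mulgA -expgD mulnA; apply: (abelian_mulgC abG); apply: groupX => //.
exact: (subsetP sTG).
Qed.

Lemma abelem2_pair (gT : finGroupType) (T : {group gT}) w v :
  2.-abelem T -> w \in T -> v \in T -> w != 1 -> v \notin <[w]> ->
  exists V : {group gT}, [/\ V \subset T, #|V| = 4, w \in V & v \in V].
Proof.
move=> abT Tw Tv ntw nwv; have [aT T2] := abelemP (isT : prime 2) abT.
have ntv: v != 1 by apply: contraNneq nwv => ->; apply: group1.
have [ow ov]: #[w] = 2 /\ #[v] = 2.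
  by split; apply: nt_prime_order; rewrite ?T2.
exists (<[w]> <*> <[v]>)%G; split.
- by rewrite join_subG !cycle_subG Tw.
- rewrite /= cent_joinEr; last by rewrite (sub_abelian_cent2 aT) ?cycle_subG.
  rewrite TI_cardMg -?orderE ?ow ?ov // setIC prime_TIg -?orderE ?ov //.
  by rewrite cycle_subG.
- by rewrite (subsetP (joing_subl _ _)) ?cycle_id.
by rewrite (subsetP (joing_subr _ _)) ?cycle_id.
Qed.

(** If |T| = 8, then V has to contain an involution w of [D]; of two subgroups of order 4 through w,
    not both contain [D], since each would then equal it. If |T| >= 16, the bound always holds. *)
Lemma abelem2_avoid (gT : finGroupType) (T D : {group gT}) :
  2.-abelem T -> 8 <= #|T| -> (#|T| = 8 -> T :&: D != 1 /\ 2 < #|D|) -> D :!=: 1 ->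
  exists V : {group gT},
    [/\ V \subset T, #|V| = 4, 16 <= #|T| * #|V :&: D| & ~~ (D \subset V)].
Proof.
move=> abT ge8 T8 ntD; have [aT T2] := abelemP (isT : prime 2) abT.
have [T_8 | T_16]: #|T| = 8 \/ 16 <= #|T|.
  move: ge8; rewrite (card_pgroup (abelem_pgroup abT)).
  case: (logn _ _) => [|[|[|[|r]]]] //; first by left.
  by right; rewrite !expnS; have := expn_gt0 2 r; lia.
- have [ntTD gt2] := T8 T_8.
  have [w /setIP[Tw Dw] ntw] := trivgPn _ ntTD.
  have ow: #[w] = 2 by apply: nt_prime_order; rewrite ?T2.
  have big (V : {group gT}) : w \in V -> 16 <= #|T| * #|V :&: D|.
    move=> Vw; rewrite T_8 (@leq_mul 8 2) // cardG_gt1.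
    by apply/trivgPn; exists w; rewrite // inE Vw.
  have [v Tv nwv]: exists2 v, v \in T & v \notin <[w]>.
    apply/subsetPn; apply: contraL ge8 => /subset_leq_card.
    by rewrite -orderE ow T_8.
  have [V [sVT cardV Vw Vv]] := abelem2_pair abT Tw Tv ntw nwv.
  have [sDV | nDV] := boolP (D \subset V); last by exists V; rewrite big.
  have [u Tu nVu]: exists2 u, u \in T & u \notin V.
    by apply/subsetPn; apply: contraL ge8 => /subset_leq_card; rewrite cardV T_8.
  have nwu: u \notin <[w]> by apply: contra nVu; apply: subsetP; rewrite cycle_subG.
  have [V' [sV'T cardV' V'w V'u]] := abelem2_pair abT Tw Tu ntw nwu.
  exists V'; rewrite big //; split=> //; apply: contra nVu => sDV'.
  have cardD: #|D| = 4.
    have := cardSg sDV; rewrite cardV => /dvdn_leq-/(_ isT).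
    have := cardSg sDV; rewrite cardV; move: gt2; clear.
    by move: #|D| => [|[|[|[|[|]]]]].
  have eqV: D = V :> {set gT} by apply/eqP; rewrite eqEcard sDV cardV cardD.
  have eqV': D = V' :> {set gT} by apply/eqP; rewrite eqEcard sDV' cardV' cardD.
  by rewrite -eqV eqV'.
(* It suffices to choose V inside some U that does not contain [D]: [T] itself if [D] meets it
   trivially, otherwise a complement in [T] of an involution of [D]. *)
have [U [abU sUT ge8U nUD]]: exists U : {group gT},
    [/\ 2.-abelem U, U \subset T, 8 <= #|U| & ~~ (D \subset U)].
  have [tiTD | ntTD] := eqVneq (T :&: D) 1.
    exists T; split=> //; apply: contra ntD => sDT.
    by rewrite -(setIidPr sDT) tiTD.
  have [w /setIP[Tw Dw] ntw] := trivgPn _ ntTD.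
  have [U [abU sUT cardU nUw _]] := abelem2_split abT Tw ntw.
  exists U; split=> //; first by move: T_16; rewrite cardU; clear; lia.
  by apply: contra nUw => sDU; apply: (subsetP sDU).
have [|V [sVU _ cardV]] := @normal_pgroup 2 _ 2 U U (abelem_pgroup abU) (normal_refl U).
  rewrite -(@leq_exp2l 2) // -(card_pgroup (abelem_pgroup abU)).
  exact: leq_trans ge8U.
exists V; rewrite cardV; split=> //; first exact: subset_trans sUT.
  by rewrite (leq_trans T_16) // leq_pmulr // cardG_gt0.
by apply: contra nUD => sDV; apply: subset_trans sVU.
Qed.

Lemma harmonious_abelian (gT : finGroupType) (G : {group gT}) :
  abelian G -> 4 <= #|square_torsion G| -> squares G != 1 -> harmonious G.
Proof.
(* The type of the group is generalized too, since quotients live in coset types. *)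
have [n] := ubnP #|G|; elim: n gT G => // n IHn gT G le_n abG.
have [T [D [defT defD sTG sDG cardG]]] := abelian_squaring_groups abG.
rewrite -{1}defT -{1}defD => ge4 ntD.
have abT := square_torsion_abelem abG defT; have [_ T2] := abelemP (isT : prime 2) abT.
have quoV (V : {group gT}) : V \subset T -> #|V| = 4 ->
    16 <= #|T| * #|V :&: D| -> ~~ (D \subset V) -> harmonious G.
  move=> sVT cardV le16 nDV; have sVG := subset_trans sVT sTG.
  have [ge4Q ntQ] := quotient_square_torsion abG defT defD sVT cardV le16 nDV.
  have gt2: 2 < #|G / V|.
    apply: leq_trans (ltnW ge4Q) _; apply: subset_leq_card.
    by apply/subsetP=> x; rewrite inE => /andP[].
  apply: (harmonious_quotient4 abG sVG (abelemS sVT abT)) => //.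
  apply: IHn; rewrite ?quotient_abelian //.
  rewrite -ltnS; apply: leq_trans le_n; rewrite ltnS card_quotient ?sub_abelian_norm //.
  by rewrite -(Lagrange sVG) ltn_Pmull ?indexg_gt0 ?cardV.
(* Here |G / T| = |D| is odd and greater than 1, so for |T| = 4 or 8 the lifting from G / T applies
   at once. *)
have oddQ : T :&: D = 1 -> [/\ harmonious (G / T), odd #|G / T| & 2 < #|G / T|].
  move=> tiTD; have oddD := odd_squares defT sDG tiTD.
  have cardQ: #|G / T| = #|D|.
    rewrite card_quotient ?sub_abelian_norm // -divgS // cardG mulKn //.
  rewrite cardQ oddD; split=> //.
    by apply: harmonious_odd; rewrite ?quotient_abelian ?cardQ.
  by move: ntD oddD; rewrite -cardG_gt1; clear; case: #|D| => [|[|[|]]].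
have [eq4 | [eq8 | ge16]]: #|T| = 4 \/ #|T| = 8 \/ 16 <= #|T|.
  move: ge4; rewrite (card_pgroup (abelem_pgroup abT)); clear.
  case: (logn _ _) => [|[|[|[|r]]]] //; [by left | by right; left | right; right].
  by rewrite !expnS; have := expn_gt0 2 r; lia.
- have [tiTD | ntTD] := eqVneq (T :&: D) 1.
    have [hQ _ gt2] := oddQ tiTD.
    exact: (harmonious_quotient4 abG sTG).
  (* A Sylow 2-subgroup P has odd index and contains every x with x^4 = 1, hence [T] and a square
     root of a nontrivial element of [T :&: D]; so P satisfies the hypotheses. *)
  have [p2 | np2] := boolP (2.-group G); last first.
    have [P sylP] := Sylow_exists 2 G.
    have sPG := pHall_sub sylP; have nsPG: P <| G by rewrite -sub_abelian_normal.
    have P4 x : x \in G -> x ^+ 4 = 1 -> x \in P.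
      move=> Gx x4; rewrite (mem_normal_Hall sylP nsPG) //.
      by apply: (@pnat_dvd _ 4); rewrite ?order_dvdn ?x4.
    apply: (harmonious_odd_overgroup abG sPG).
      by case/and3P: sylP => _ _; rewrite odd_2'nat.
    apply: IHn.
    + rewrite -ltnS; apply: leq_trans le_n; rewrite ltnS proper_card //.
      rewrite properEneq sPG andbT; apply: contraNneq np2 => <-.
      exact: pHall_pgroup sylP.
    + exact: abelianS sPG abG.
    + rewrite -eq4; apply: subset_leq_card; apply/subsetP=> x Tx.
      rewrite inE T2 // eqxx andbT; apply: P4; first exact: (subsetP sTG).
      by rewrite (expgM x 2 2) T2 ?groupX.
    have [w /setIP[Tw]] := trivgPn _ ntTD.
    rewrite defD => /imsetP[x Gx def_w]; apply: contraNneq => sq1.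
    have: w \in squares P.
      rewrite def_w; apply: imset_f; apply: P4 => //.
      by rewrite (expgM x 2 2) -def_w T2.
    by rewrite sq1 => /set1P->.
  (* If [T] is not inside [D], then |T :&: D| = 2. If it is, V = T qualifies unless T = D, and then
     |G| = 16. *)
  have [sTD | nTD] := boolP (T \subset D); last first.
    apply: (harmonious_torsion_meet2 abG defT defD) => //; last by rewrite cardG eq4.
    have: #|T :&: D| %| 4 by rewrite -eq4 cardSg ?subsetIl.
    have: #|T :&: D| < 4.
      rewrite -eq4 proper_card // properEneq subsetIl andbT.
      by apply: contra nTD => /eqP/setIidPl.
    move: ntTD; rewrite -cardG_gt1; clear.
    by case: #|_| => [|[|[|[|]]]].
  have [sDT | nDT] := boolP (D \subset T); last first.
    by apply: (quoV T) => //; rewrite (setIidPl sTD) eq4.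
  have eqTD: T = D :> {set gT} by apply/eqP; rewrite eqEsubset sTD.
  apply: (harmonious_squares_torsion4 abG defT) => //; first by rewrite eqTD.
  by rewrite cardG -eqTD eq4.
- have [tiTD | ntTD] := eqVneq (T :&: D) 1.
    have [hQ oQ gt2] := oddQ tiTD.
    exact: (harmonious_quotient8 abG sTG).
  have [D_le2 | D_gt2] := leqP #|D| 2.
    have cardD: #|D| = 2 by apply/eqP; rewrite eqn_leq D_le2 cardG_gt1.
    have [w /setIP[Tw Dw] ntw] := trivgPn _ ntTD.
    by apply: (harmonious_squares2 abG defT defD) Tw Dw ntw; rewrite // cardG eq8 cardD.
  have [||||V [sVT cardV le16 nDV]] := @abelem2_avoid _ T D; rewrite ?eq8 //.
  exact: (quoV V).
have [||||V [sVT cardV le16 nDV]] := @abelem2_avoid _ T D; rewrite ?(leq_trans _ ge16) //.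
  by move=> eq8; rewrite eq8 in ge16.
exact: (quoV V).
Qed.

(** * Open webs *)

(** Supplies the hypotheses of [harmonious_abelian]: the four elements (a, b s) are 2-torsion, and
    (0, 1) has the nonzero double (0, 2) because 2s > 2. *)
Lemma isog_Z2xZ2s_square (gT : finGroupType) (H K : {group gT}) s :
  1 < s -> K \subset H -> K \isog [set: ('Z_2 * 'Z_(2 * s))%type] ->
  4 <= #|square_torsion H| /\ squares H != 1.
Proof.
move=> s_gt1 sKH; rewrite isog_sym => /isogP[g /injmP inj_g img].
have ltp : 1 < 2 * s by lia.
have gH x : g x \in H by rewrite (subsetP sKH) // -img mem_morphim ?inE.
pose t (u : bool * bool) : ('Z_2 * 'Z_(2 * s))%type :=
  ((u.1 : nat)%:R%R, (u.2 * s)%:R%R).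
have inj_t : injective t.
  move=> [a b] [c d] [/(congr1 val) + /(congr1 val)].
  rewrite /= !val_Zp_nat //.
  by case: a; case: c => //= _; case: b; case: d => //=;
    rewrite ?mul1n ?mul0n ?mod0n modn_small //; lia.
have t2 u : t u * t u = 1.
  congr pair; rewrite /=.
    by case: (u.1); apply/val_inj.
  change ((u.2 * s)%:R + (u.2 * s)%:R = 0 :> 'Z_(2 * s))%R.
  apply/val_inj; rewrite -GRing.natrD /= val_Zp_nat //.
  by case: (u.2); rewrite ?mul1n ?mul0n ?mod0n // addnn -mul2n modnn.
split.
  have <-: #|[set g (t u) | u : bool * bool]| = 4.
    rewrite card_imset ?card_prod ?card_bool // => u v /inj_g eq_uv.
    by apply: inj_t; apply: eq_uv; rewrite inE.
  apply: subset_leq_card; apply/subsetP=> _ /imsetP[u _ ->].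
  by rewrite inE gH -morphX ?inE // -[_ ^+ 2]/(t u * t u) t2 morph1 eqxx.
pose x : ('Z_2 * 'Z_(2 * s))%type := (0%R, 1%R).
apply/eqP=> sq1.
have: g (x ^+ 2) \in squares H by rewrite morphX ?inE //; apply: imset_f.
rewrite sq1 => /set1P; rewrite -(morph1 g) => /inj_g.
rewrite !inE => /(_ isT isT) /(congr1 snd)/(congr1 val).
change (nat_of_ord (1%:R + 1%:R : 'Z_(2 * s))%R = 0 -> False).
by rewrite -GRing.natrD val_Zp_nat // modn_small //; lia.
Qed.

(** Every weight is attained and there are at most |Gamma| edges, so counting makes the weight map
    injective. *)
Lemma harmonious_labeling_open_web (m n : nat) (Gamma : finZmodType)
    (H : {group Gamma}) :
  3 <= n -> 2 <= m -> #|Gamma| = ((2 * m - 1) * n)%N -> #|H| = n ->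
  harmonious H -> cyclic ([set: Gamma] / H) ->
  exists f : option ('I_m * 'I_n) -> Gamma, harmonious_labeling (@open_web m n) f.
Proof.
(* From here on m and n are one less than in the statement, so Gamma / H has order 2m + 1. *)
case: n => // n n_ge3; case: m => // m m_ge2 cardGamma cardH [h hH] /cyclicP[gbar defQ].
have abGamma := FinRing.zmod_abelian [set: Gamma].
have nH x : x \in 'N(H).
  by rewrite (subsetP (sub_abelian_norm abGamma (subsetT H))) ?inE.
have [hP h1 h2] := hH; rewrite cardH in hP.
have ordg : #[gbar] = (2 * m).+1.
  rewrite orderE -defQ card_quotient; last by apply/subsetP=> x _; apply: nH.
  rewrite -divgS ?subsetT // cardsT cardGamma cardH mulnK //; lia.
have [g eg] : exists g, gbar = coset H g.
  have: gbar \in [set: Gamma] / H by rewrite defQ cycle_id.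
  by case/morphimP=> g _ _ ->; exists g.
have cosetX i k : k \in H -> coset H (g ^+ i * k) = gbar ^+ i.
  by move=> Hk; rewrite morphM ?nH //= (coset_id Hk) mulg1 morphX ?nH // eg.
have hH' t : h t \in H := harmonious_mem t hH.
have decomp y : exists c k, [/\ c < (2 * m).+1, k \in H & y = g ^+ c * k].
  have: coset H y \in <[gbar]> by rewrite -defQ mem_quotient ?inE.
  case/cyclePmin=> c; rewrite ordg => lt_c eq_c.
  have [|||k Hk ->] := @kercoset_rcoset _ H y (g ^+ c); rewrite ?nH //.
    by rewrite morphX ?nH //= -eg.
  by exists c, k; split=> //; apply: (abelian_mulgC abGamma); rewrite inE.
pose f (u : option ('I_m.+1 * 'I_n.+1)) : Gamma :=
  if u is Some (i, j) then g ^+ i * h (i + j) else g ^+ (2 * m).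
pose vtx i j : option ('I_m.+1 * 'I_n.+1) := Some (inord i, inord j).
have fE i j : i <= m -> f (vtx i (j %% n.+1)) = g ^+ i * h (i + j).
  move=> le_i; rewrite /f /= !inordK ?ltn_mod //; congr (_ * _).
  rewrite -[LHS](harmonious_modn _ hH) -[RHS](harmonious_modn _ hH) cardH.
  by rewrite modnDmr.
(* The pair (c, j) names an edge with weight in coset c: a spoke for c = 2m, a rung for odd c, a
   cycle edge of layer c / 2 for even c < 2m. The coset 2m is free for the spokes because the bottom
   cycle is deleted. *)
pose E (p : 'I_(2 * m).+1 * 'I_n.+1) : {set option ('I_m.+1 * 'I_n.+1)} :=
  if p.1 == (2 * m)%N :> nat then [set None; vtx 0 p.2]
  else if odd p.1 then [set vtx p.1./2 p.2; vtx p.1./2.+1 p.2]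
  else [set vtx p.1./2 p.2; vtx p.1./2 (p.2.+1 %% n.+1)].
have sub_E : edge_set (@open_web m.+1 n.+1) \subset E @: setT.
  apply/subsetP=> _ /imset2P[u v _ + ->]; rewrite inE /= => uv.
  have sym_uv : open_web v u by rewrite open_web_sym.
  have E_spoke j : [set None; Some (ord0, j)] \in E @: setT.
    apply/imsetP; exists (ord_max, j); rewrite ?inE // /E /= eqxx.
    by rewrite /vtx inord_val (_ : inord 0 = ord0) //; apply/val_inj; rewrite /= inordK.
  have E_rung (i i' : 'I_m.+1) j : i' = i.+1 :> nat ->
      [set Some (i, j); Some (i', j)] \in E @: setT.
    move=> ei'; have lt_i : (2 * i).+1 < (2 * m).+1 by have := ltn_ord i'; lia.
    apply/imsetP; exists (Ordinal lt_i, j); rewrite ?inE // /E /=.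
    rewrite ifF; last by apply/eqP; lia.
    rewrite ifT; last by lia.
    by rewrite /vtx mul2n uphalf_double -ei' !inord_val.
  have E_cycle (i : 'I_m.+1) (j j' : 'I_n.+1) : i != m :> nat ->
      j' = j.+1 %% n.+1 :> nat -> [set Some (i, j); Some (i, j')] \in E @: setT.
    move=> ni ej'; have lt_i : (2 * i)%N < (2 * m).+1 by have := ltn_ord i; lia.
    apply/imsetP; exists (Ordinal lt_i, j); rewrite ?inE // /E /=.
    rewrite ifF; last by apply/eqP; move/eqP: ni; lia.
    rewrite ifF; last by lia.
    by rewrite /vtx mul2n doubleK -ej' !inord_val.
  case: u v uv sym_uv => [[i j]|] [[i' j']|] //=.
  - rewrite /prism /cartesian_graph /bottom_cycle /in_bottom /= => /andP[+ nb] _.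
    case/orP=> /andP[/eqP /= eq_ij].
      subst i' => cyc; have ni : i != m :> nat.
        by apply: contra nb => /eqP ei; rewrite /bottom_cycle /in_bottom /= ei eqxx.
      case/orP: cyc => /eqP ej'; first exact: E_cycle.
      by rewrite setUC; apply: E_cycle.
    subst j'; case/orP=> /eqP ei'; first exact: E_rung.
    by rewrite setUC; apply: E_rung.
  - case/andP=> /eqP /= i0 _ _.
    by rewrite setUC (_ : i = ord0) //; apply/val_inj.
  - case/andP=> /eqP /= i0 _ _.
    by rewrite (_ : i' = ord0) //; apply/val_inj.
have surj y : exists2 A, A \in edge_set (@open_web m.+1 n.+1) & edge_weight f A = y.
  have edgeP u v z : open_web u v -> f u * f v = z ->
      exists2 A, A \in edge_set (@open_web m.+1 n.+1) & edge_weight f A = z.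
    move=> uv fuv; exists [set u; v].
      by apply/imset2P; exists u v; rewrite ?inE.
    rewrite edge_weight2 //; apply: contraTneq uv => ->.
    by rewrite open_web_irrefl //; lia.
  have shift i t : exists2 j, j < n.+1 & h (i + j) = h t /\ h (i + j).+1 = h t.+1.
    (* Modulo n + 1 the product i n is -i, so j is t - i. *)
    exists ((t + i * n) %% n.+1); first by rewrite ltn_mod.
    have hE u v : (u = v %[mod n.+1])%N -> h u = h v.
      move=> uv; rewrite -(harmonious_modn u hH) cardH uv -cardH.
      exact: harmonious_modn.
    have e : (i + (t + i * n) %% n.+1 = t %[mod n.+1])%N.
      by rewrite modnDmr addnCA -mulnS addnC modnMDl.
    by split; apply: hE; rewrite // -addn1 -modnDml e modnDml addn1.
  have [c [k [lt_c Hk ->]]] := decomp y.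
  have Cg i x : g ^+ i * x = x * g ^+ i.
    by apply: (abelian_mulgC abGamma); rewrite inE.
  have gM i j x z : g ^+ i * x * (g ^+ j * z) = g ^+ (i + j) * (x * z).
    by rewrite expgD -!mulgA; congr (_ * _); rewrite mulgA -Cg -mulgA.
  have vtxE i j : i <= m -> j < n.+1 -> f (vtx i j) = g ^+ i * h (i + j).
    by move=> le_i lt_j; rewrite -fE // modn_small.
  have [-> | nc] := eqVneq c (2 * m)%N.
    have [t ->] := h1 k Hk; have [j lt_j [<- _]] := shift 0 t.
    apply: (edgeP None (vtx 0 j)).
      by rewrite /open_web /closed_web /= /in_top /= inordK.
    by rewrite vtxE // mul1g.
  have [t ->] := h2 k Hk; have lt_c2 : c./2 < m by lia.
  have [j lt_j [<- <-]] := shift c./2 t.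
  have [odd_c | even_c] := boolP (odd c).
    apply: (edgeP (vtx c./2 j) (vtx c./2.+1 j)).
      rewrite /open_web /closed_web /bottom_cycle /= /prism.
      rewrite /cartesian_graph /in_bottom /path_graph /=.
      by rewrite !inordK ?eqxx ?orbT ?eqSS ?(ltn_eqF lt_c2) //; lia.
    rewrite !vtxE //; last by lia.
    by rewrite gM addSn; congr (_ ^+ _ * _); lia.
  apply: (edgeP (vtx c./2 j) (vtx c./2 (j.+1 %% n.+1))).
    rewrite /open_web /closed_web /bottom_cycle /= /prism.
    rewrite /cartesian_graph /in_bottom /cycle_graph /=.
    by rewrite !inordK ?eqxx ?orbT ?eqSS ?(ltn_eqF lt_c2) ?ltn_mod //; lia.
  rewrite vtxE ?fE //; try lia.
  by rewrite gM addnS; congr (_ ^+ _ * _); lia.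
have img : edge_weight f @: edge_set (@open_web m.+1 n.+1) = [set: Gamma].
  by apply/setP=> y; rewrite inE; have [A EA <-] := surj y; apply: imset_f.
have card_E : #|edge_set (@open_web m.+1 n.+1)| <= #|Gamma|.
  apply: leq_trans (subset_leq_card sub_E) _.
  apply: leq_trans (leq_imset_card _ _) _.
  by rewrite cardsT card_prod !card_ord cardGamma leq_mul2r; lia.
exists f; split=> //; last first.
  by apply/imset_injP; rewrite eqn_leq leq_imset_card img cardsT.
(* Injectivity of [f]: the exponents 0, ..., m and 2m are distinct modulo 2m + 1, and h is injective
   over one period. *)
have expI i i' : i < (2 * m).+1 -> i' < (2 * m).+1 -> gbar ^+ i = gbar ^+ i' -> i = i'.
  move=> lt_i lt_i' /eqP; rewrite eq_expg_mod_order ordg => /eqP.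
  by rewrite !modn_small.
have ltI (i : 'I_m.+1) : i < (2 * m).+1 by have := ltn_ord i; lia.
have none i x : x \in H -> i <= m -> g ^+ i * x <> g ^+ (2 * m).
  move=> Hx le_i /(congr1 (coset H)); rewrite cosetX // -[g ^+ (2 * m)]mulg1 cosetX //.
  by move=> /expI; lia.
case=> [[i j]|] [[i' j']|] //= eq_f.
- have := congr1 (coset H) eq_f; rewrite !cosetX // => /(expI _ _ (ltI i) (ltI i')).
  move=> /ord_inj ei; move: eq_f; rewrite -ei => /mulgI.
  rewrite -[LHS](harmonious_modn _ hH) -[RHS](harmonious_modn _ hH) cardH.
  have [_ injh] := harmonious_image hH; rewrite cardH in injh.
  move/injh; rewrite !inE !ltn_mod => /(_ isT isT)/eqP.
  by rewrite eqn_modDl !modn_small // => /eqP/ord_inj->.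
- by have := none i (h (i + j)) (hH' _) (ltn_ord i).
by have := none i' (h (i' + j')) (hH' _) (ltn_ord i'); rewrite eq_f.
Qed.

End HarmoniousGroups.

Theorem theorem8p7 (m n : nat) (Gamma : finZmodType) (H : {group Gamma})
    (n_ge3 : 3 <= n) (m_ge2 : 2 <= m)
    (card_Gamma : #|Gamma| = (2 * m - 1) * n)
    (card_H : #|H| = n)
    (H_cond : odd n \/
       ~~ odd n /\
       exists s : nat, exists K : {group Gamma},
         [/\ 2 <= s, K \subset H
           & (K \isog [set: ('Z_2 * 'Z_(2 * s))%type])%g])
    (cyclic_quotient : cyclic ([set: Gamma] / H)%g) :
  exists f : option ('I_m * 'I_n) -> Gamma,
    harmonious_labeling (@open_web m n) f.
Proof.
apply: (harmonious_labeling_open_web n_ge3 m_ge2 card_Gamma card_H) => //.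
have abH : abelian H := FinRing.zmod_abelian H.
case: H_cond => [odd_n | [_ [s [K [s_ge2 sKH isoK]]]]].
  by apply: harmonious_odd; rewrite ?card_H.
by have [] := isog_Z2xZ2s_square s_ge2 sKH isoK; apply: harmonious_abelian.
Qed.
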